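(* Let $b_0 \leq b_1 \leq b_2 \leq \cdots$ be a nondecreasing sequence of nonnegative integers (the barrier). For $n \geq 0$, let $f(n)$ denote the number of integer sequences $(a_0, a_1, \ldots, a_n)$ with $0 \leq a_0 \leq a_1 \leq \cdots \leq a_n$ and $a_j \leq b_j$ for all $0 \leq j \leq n$. Then for every $n = 0, 1, 2, \ldots$, $$f(n) = (-1)^n \binom{b_0 + 1}{n+1} + \sum_{0 \leq m < n} (-1)^{m+n+1} \binom{1+b_{m+1}}{n-m} f(m).$$
   Context: Binomial coefficients $\binom{N}{k}$ with $N$ a nonnegative integer and $k > N$ are equal to $0$. *)

(* Defs.v *)
From mathcomp Require Import all_boot all_order all_algebra.

Set Implicit Arguments.
Unset Strict Implicit.
Unset Printing Implicit Defensive.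

(* The entries are taken in 'I_(b n).+1 only to make the type finite: this
   excludes no sequence, since a_j <= a_n <= b_n for every j <= n. *)
Definition barrier_seqs (b : nat -> nat) (n : nat) :
    {set n.+1.-tuple 'I_(b n).+1} :=
  [set a : n.+1.-tuple 'I_(b n).+1 |
    sorted leq (map val a) && [forall j : 'I_n.+1, tnth a j <= b j]].

Definition barrier_count (b : nat -> nat) (n : nat) : nat :=
  #|barrier_seqs b n|.

(* Main.v *)
Require Import Defs.
From mathcomp Require Import all_boot all_order all_algebra.
Set Implicit Arguments.
Unset Strict Implicit.
Unset Printing Implicit Defensive.
Import Order.TTheory GRing.Theory Num.Theory.
Local Open Scope ring_scope.

(** Fix [n], and for [m <= n] let [P m] be the number of sequences
    [a_0 <= ... <= a_m > c_(m+1) > ... > c_n >= 0] with [a_j <= b_j], so that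
    [P n = f n] and [P 0 = 'C(b_0 + 1, n + 1)].  For [m < n], take a valid
    [a_0 <= ... <= a_m] and, independently, a strictly decreasing
    [c_(m+1) > ... > c_n] with entries in [0, b_(m+1)]; such pairs number
    ['C(1 + b_(m+1), n - m) * f m].  Comparing [a_m] with [c_(m+1)] shows that
    they also number [P m + P (m+1)].  Alternately summing over [m] gives
    the formula.  Once [c_(m+1) > ... > c_n] are summed out, [P m] is
    [barrier_sum b m (fun v => 'C(v, n - m))]. *)

(** Stated on plain lists, independently of the length and of the bound in the entry type, so that
    induction can append a last entry. *)
Definition under_barrier (b : nat -> nat) (s : seq nat) : bool :=
  sorted leq s && all (fun j => nth 0 s j <= b j)%N (iota 0 (size s)).

Lemma under_barrier_rcons (b : nat -> nat) (s : seq nat) (x : nat) :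
  s != [::] ->
  under_barrier b (rcons s x) =
  [&& under_barrier b s, last 0 s <= x & x <= b (size s)]%N.
Proof.
move=> s0; rewrite /under_barrier size_rcons -addn1 iotaD all_cat /=.
have -> : sorted leq (rcons s x) = sorted leq s && (last 0 s <= x)%N.
  by case: s s0 => // y s _; rewrite rcons_cons /= rcons_path.
rewrite add0n nth_rcons ltnn eqxx andbT.
have -> : all (fun j => nth 0 (rcons s x) j <= b j)%N (iota 0 (size s)) =
    all (fun j => nth 0 s j <= b j)%N (iota 0 (size s)).
  by apply: eq_in_all => j; rewrite mem_iota nth_rcons => /andP[_ ->].
by rewrite -!andbA; congr (_ && _); rewrite andbCA.
Qed.

Lemma big_tuple_rcons (V : nmodType) (T : finType) (n : nat)
    (F : n.+1.-tuple T -> V) :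
  \sum_t F t = \sum_(t : n.-tuple T) \sum_x F [tuple of rcons t x].
Proof.
rewrite pair_big /=.
apply: (reindex (fun p : n.-tuple T * T => [tuple of rcons p.1 p.2])).
(* Appending is injective, and both sides have the same cardinality. *)
apply: onW_bij; apply: inj_card_bij => [[s x] [t y] /(congr1 val) /=|].
  by case/rcons_inj => /val_inj -> ->.
by rewrite card_prod !card_tuple expnSr.
Qed.

(* [barrier_sum b m g] is the sum of [g a_m] over the sequences
   [a_0 <= ... <= a_m] with [a_j <= b j]. *)
Fixpoint barrier_sum (b : nat -> nat) (m : nat) (g : nat -> int) : int :=
  if m is p.+1
  then barrier_sum b p (fun u => \sum_(u <= v < (b m).+1) g v)
  else \sum_(0 <= v < (b 0%N).+1) g v.

Lemma eq_barrier_sum (b : nat -> nat) (m : nat) (g h : nat -> int) :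
  (forall v, (v <= b m)%N -> g v = h v) ->
  barrier_sum b m g = barrier_sum b m h.
Proof.
elim: m g h => [|m IHm] g h gh /=.
  by apply: eq_big_nat => v /andP[_ /gh].
by apply: IHm => u _; apply: eq_big_nat => v /andP[_ /gh].
Qed.

Lemma barrier_sumD (b : nat -> nat) (m : nat) (g h : nat -> int) :
  barrier_sum b m (fun v => g v + h v) = barrier_sum b m g + barrier_sum b m h.
Proof.
elim: m g h => [|m IHm] g h /=; first exact: big_split.
by rewrite -IHm; apply: eq_barrier_sum => u _; rewrite big_split.
Qed.

Lemma barrier_sumZ (b : nat -> nat) (m : nat) (c : int) (g : nat -> int) :
  barrier_sum b m (fun v => c * g v) = c * barrier_sum b m g.
Proof.
elim: m g => [|m IHm] g /=; first by rewrite mulr_sumr.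
by rewrite -IHm; apply: eq_barrier_sum => u _; rewrite mulr_sumr.
Qed.

Lemma sum_ord_geq_leq (N u c : nat) (g : nat -> int) : (c < N)%N ->
  \sum_(x < N | (u <= x <= c)%N) g x = \sum_(u <= v < c.+1) g v.
Proof.
move=> cN; rewrite (big_nat_widen _ _ _ _ _ cN) big_geq_mkord /=.
by apply: eq_bigl => x; rewrite andbC.
Qed.

(** One [N] exceeding all the bounds keeps the entry type ['I_N] fixed while [m] varies in the
    induction. *)
Lemma sum_tuple_barrier (b : nat -> nat) (N m : nat) (g : nat -> int) :
  (forall j, (j <= m)%N -> (b j < N)%N) ->
  \sum_(t : m.+1.-tuple 'I_N | under_barrier b (map val t))
     g (last 0 (map val t)) = barrier_sum b m g.
Proof.
elim: m g => [|m IHm] g bN; rewrite big_mkcond big_tuple_rcons /=.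
  rewrite (big_pred1 [tuple]) => [|t]; last by rewrite [t]tuple0 /= eqxx.
  rewrite -(@sum_ord_geq_leq N) ?bN // [RHS]big_mkcond /=; apply: eq_bigr => x _.
  by rewrite /under_barrier /= andbT.
rewrite -IHm => [|j jm]; last by rewrite bN // leqW.
rewrite [RHS]big_mkcond; apply: eq_bigr => t _.
rewrite -(@sum_ord_geq_leq N) ?bN // [in RHS]big_mkcond /=.
case: ifP => okt; last rewrite big1 // => x _.
  apply: eq_bigr => x _.
  rewrite map_rcons under_barrier_rcons ?okt ?last_rcons ?size_map ?size_tuple //.
  by rewrite -size_eq0 size_map size_tuple.
by rewrite map_rcons under_barrier_rcons ?okt // -size_eq0 size_map size_tuple.
Qed.

Lemma barrier_countE (b : nat -> nat) (n : nat) :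
  (forall j, (b j <= b j.+1)%N) ->
  (barrier_count b n)%:Z = barrier_sum b n (fun=> 1).
Proof.
move=> hb; rewrite /barrier_count -sum1_card.
(* This [N] is the one in the type of [barrier_seqs b n]; monotonicity of [b] makes it large
   enough. *)
rewrite -(@sum_tuple_barrier _ (b n).+1) => [|j jn]; last first.
  by rewrite ltnS; apply: (homo_leq (@leqnn) leq_trans hb).
rewrite -natz natr_sum; apply: eq_bigl => t; rewrite inE.
congr (_ && _); rewrite size_map size_tuple.
apply/forallP/allP => [bt j|bt j].
  rewrite mem_iota add0n => /andP[_ jn].
  by have := bt (Ordinal jn); rewrite (tnth_nth ord0) (nth_map ord0) ?size_tuple.
have := bt j; rewrite mem_iota add0n ltn_ord (nth_map ord0) ?size_tuple //.
by rewrite (tnth_nth ord0); apply.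
Qed.

(** Pascal's rule makes the sum telescope. *)
Lemma sum_bin_col (u c k : nat) : (u <= c)%N ->
  \sum_(u <= v < c) 'C(v, k)%:Z = 'C(c, k.+1)%:Z - 'C(u, k.+1)%:Z.
Proof.
move=> uc; rewrite -(telescope_sumr (fun v => 'C(v, k.+1)%:Z) uc).
by apply: eq_bigr => v _; rewrite binS PoszD addrAC subrr add0r.
Qed.

(** This is the relation between [P m] and [P (m+1)]: for a fixed [a_m = u], summing the column from
    [u] to [b_(m+1)] leaves a constant minus ['C(u, k.+1)]. *)
Lemma barrier_sum_binS (b : nat -> nat) (m k : nat) :
  (b m <= b m.+1)%N ->
  barrier_sum b m.+1 (fun v => 'C(v, k)%:Z) =
  'C(1 + b m.+1, k.+1)%:Z * barrier_sum b m (fun=> 1)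
  - barrier_sum b m (fun v => 'C(v, k.+1)%:Z).
Proof.
move=> bm; rewrite [LHS]/= -mulN1r -!barrier_sumZ -barrier_sumD.
apply: eq_barrier_sum => u ub.
by rewrite sum_bin_col ?mulr1 ?mulN1r // leqW // (leq_trans ub).
Qed.

(** Each descent from [m.+1] to [m] raises [k] by one, so the induction needs all [k] at once. *)
Lemma barrier_sum_bin (b : nat -> nat) (m k : nat) :
  (forall j, (b j <= b j.+1)%N) ->
  barrier_sum b m (fun v => 'C(v, k)%:Z) =
  (-1) ^+ m * 'C(b 0%N + 1, m + k + 1)%:Z
  + \sum_(0 <= i < m) (-1) ^+ (i + m + 1) * 'C(1 + b i.+1, m + k - i)%:Z
      * barrier_sum b i (fun=> 1).
Proof.
move=> hb; elim: m k => [|m IHm] k.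
  by rewrite big_geq // addr0 mul1r /= sum_bin_col // bin0n subr0 !addn1.
rewrite barrier_sum_binS // IHm big_nat_recr //= [LHS]addrC opprD -[LHS]addrA.
rewrite exprS mulN1r mulNr; congr (_ + (_ + _)).
- by rewrite addSnnS.
- rewrite -sumrN; apply: eq_bigr => i _.
  by rewrite (addSnnS m k) (addnS i) addSn exprS mulN1r !mulNr.
(* The split-off term [i = m] has the even exponent [2(m+1)], hence sign [+1]. *)
- rewrite addn1 -addSn addnn -signr_odd odd_double mul1r.
  by congr ('C(_, _)%:Z * _); rewrite addSnnS addKn.
Qed.

Theorem theorem1 (b : nat -> nat) (hb : forall j : nat, (b j <= b j.+1)%N)
    (n : nat) :
  (barrier_count b n)%:Z =
    (-1) ^+ n * ('C(b 0%N + 1, n + 1))%:Z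
    + \sum_(0 <= m < n)
        (-1) ^+ (m + n + 1) * ('C(1 + b m.+1, n - m))%:Z * (barrier_count b m)%:Z.
Proof.
rewrite barrier_countE //.
(* The count is the case [k = 0]. *)
have -> : barrier_sum b n (fun=> 1) = barrier_sum b n (fun v => 'C(v, 0)%:Z).
  by apply: eq_barrier_sum => v _; rewrite bin0.
rewrite barrier_sum_bin // addn0; congr (_ + _).
by apply: eq_bigr => m _; rewrite barrier_countE.
Qed.
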